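(* $\Gamma_{\max}$ is perfect.
   Context: For a totally ordered group $(\Gamma,\cdot,<)$, $\Gamma_{\max}$ is the skew hyperfield on $\Gamma\cup\{0\}$ with multiplication from $\Gamma$ ($0$ absorbing) and hyperaddition $x\boxplus y=\{\max\{x,y\}\}$ if $x\neq y$ and $x\boxplus x=\{z\in\Gamma:z\le x\}\cup\{0\}$, with $x\boxplus 0=\{x\}$ and $0<x$ for all $x\in\Gamma$. For $X,Y\in H^E$ with $E=\{e_1,\dots,e_n\}$, $X\perp Y$ means $0\in X_{e_1}Y_{e_1}\boxplus\cdots\boxplus X_{e_n}Y_{e_n}$. For a left matroid $M$ over a skew hyperfield, vectors are the $V$ orthogonal to all cocircuits and covectors are the $U$ with every circuit orthogonal to $U$; $M$ is perfect if every vector is orthogonal to every covector, and a hyperfield is perfect if all left matroids over it are perfect. *)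

(* Defs.v *)
From HB Require Import structures.
From mathcomp Require Import all_boot all_order.
From mathcomp Require Import boolp classical_sets.

Set Implicit Arguments.
Unset Strict Implicit.
Unset Printing Implicit Defensive.

Import Order.TTheory.
Local Open Scope classical_set_scope.
Local Open Scope order_scope.
Local Open Scope group_scope.

(* Totally ordered groups, not necessarily abelian; the order is invariant
   under translations on both sides. *)
HB.mixin Record Group_Total_isOrderedGroup (d : Order.disp_t) G
    of Group G & Order.Total d G := {
  ltg_mul2l : forall z x y : G, x < y -> z * x < z * y;
  ltg_mul2r : forall z x y : G, x < y -> x * z < y * z
}.

#[short(type="orderedGroupType")]
HB.structure Definition OrderedGroup (d : Order.disp_t) :=
  {G of Group_Total_isOrderedGroup d G & Group G & Order.Total d G}.

(* The extension of a hyperoperation to sets. *)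
Definition set_hyperop (T : Type) (op : T -> T -> set T) (A B : set T) : set T :=
  \bigcup_(a in A) \bigcup_(b in B) op a b.

HB.mixin Record Monoid_isSkewHyperfield H of Monoid H := {
  hzero : H;
  hopp : H -> H;
  hadd : H -> H -> set H;
  hadd_neq0 : forall x y, hadd x y !=set0;
  haddC : forall x y, hadd x y = hadd y x;
  haddA : forall x y z,
    set_hyperop hadd [set x] (hadd y z) = set_hyperop hadd (hadd x y) [set z];
  hadd0 : forall x, hadd x hzero = [set x];
  hadd_opp : forall x y, hadd x y hzero <-> y = hopp x;
  hadd_rev : forall x y z, hadd y z x -> hadd x (hopp y) z;
  hmul0 : forall x : H, hzero * x = hzero;
  hmulr0 : forall x : H, x * hzero = hzero;
  hmulDr : forall a x y : H,
    [set a * z | z in hadd x y] = hadd (a * x) (a * y);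
  hmulDl : forall a x y : H,
    [set z * a | z in hadd x y] = hadd (x * a) (y * a);
  hone_neq0 : (1 : H) != hzero;
  hmul_inv : forall x : H, x != hzero -> exists y : H, x * y = 1 /\ y * x = 1
}.

#[short(type="skewHyperfieldType")]
HB.structure Definition SkewHyperfield :=
  {H of Monoid_isSkewHyperfield H & Monoid H}.

Section HyperVectors.
Variables (H : skewHyperfieldType) (E : finType).
Implicit Types X Y Z : {ffun E -> H}.

Definition supp X : {set E} := [set e | X e != hzero]%SET.

Definition orthogonal X Y : Prop :=
  (\big[set_hyperop hadd/[set hzero]]_(e : E) [set X e * Y e]) hzero.

Definition supports (C : set {ffun E -> H}) : {set {set E}} :=
  [set A | `[< exists2 X, C X & supp X = A >]]%SET.

End HyperVectors.

Section MatroidCircuits.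
Variables (E : finType) (F : {set {set E}}).
Implicit Types A B I D : {set E}.

(* Distinctness of A and B matters: a pair A = A would satisfy the second
   condition, but has height 1 rather than 2 in the lattice of unions. *)
Definition modular_pair A B : bool :=
  (A != B) &&
  [forall A' in F, forall B' in F,
     (A' != B') ==> ~~ (A' :|: B' \proper A :|: B)%SET].

Definition independent I : bool := [forall A in F, ~~ (A \subset I)].

Definition basis B : bool := maxset independent B.

(* Independence in the dual matroid, whose bases are the complements of the
   bases of the matroid with set of circuits F. *)
Definition coindependent I : bool := [exists B, basis B && (I \subset ~: B)%SET].

Definition cocircuit_support D : bool :=
  minset (fun D' => ~~ coindependent D') D.

End MatroidCircuits.

Record left_matroid (H : skewHyperfieldType) (E : finType) := LeftMatroid {
  circuits : set {ffun E -> H};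
  circuit_neq0 : ~ circuits [ffun => hzero];
  circuit_scale : forall (X : {ffun E -> H}) (a : H),
    circuits X -> a != hzero -> circuits [ffun e => a * X e];
  circuit_incomparable : forall X Y : {ffun E -> H},
    circuits X -> circuits Y -> supp X \subset supp Y ->
    exists2 a : H, a != hzero & Y = [ffun e => a * X e];
  circuit_modular_elim : forall (X Y : {ffun E -> H}) (e : E),
    circuits X -> circuits Y ->
    modular_pair (supports circuits) (supp X) (supp Y) ->
    X e = hopp (Y e) -> X e != hzero ->
    exists Z : {ffun E -> H},
      [/\ circuits Z, Z e = hzero & forall f, hadd (X f) (Y f) (Z f)]
}.

Section Perfection.
Variables (H : skewHyperfieldType) (E : finType) (M : left_matroid H E).

(* The circuits of the dual right matroid of M: this dual is the unique right
   H-signature of the dual of the underlying matroid which is 3-orthogonal to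
   the circuits of M, i.e. orthogonality is required only for supports meeting
   in at most 3 elements (over a general skew hyperfield, circuits and
   cocircuits need not be orthogonal otherwise). *)
Definition cocircuits : set {ffun E -> H} :=
  [set Y | cocircuit_support (supports (circuits M)) (supp Y) /\
           forall X, circuits M X -> (#|supp X :&: supp Y|%SET <= 3)%N ->
             orthogonal X Y].

Definition vectors : set {ffun E -> H} :=
  [set V | forall Y, cocircuits Y -> orthogonal V Y].

Definition covectors : set {ffun E -> H} :=
  [set U | forall X, circuits M X -> orthogonal X U].

Definition perfect_matroid : Prop :=
  forall V U, vectors V -> covectors U -> orthogonal V U.

End Perfection.

Definition perfect_hyperfield (H : skewHyperfieldType) : Prop :=
  forall (E : finType) (M : left_matroid H E), perfect_matroid M.

(* None is the zero element. *)
Definition Gamma_max (d : Order.disp_t) (G : orderedGroupType d) : Type :=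
  option G.

Section GammaMax.
Variables (d : Order.disp_t) (G : orderedGroupType d).
Local Notation H := (Gamma_max G).
Implicit Types (x y z : H) (a b c : G).

HB.instance Definition _ := Choice.on H.

Definition gmax_mul x y : H :=
  match x, y with
  | Some a, Some b => Some (a * b)
  | _, _ => None
  end.

Definition gmax_add x y : set H :=
  match x, y with
  | None, _ => [set y]
  | _, None => [set x]
  | Some a, Some b =>
      if a == b then [set z : H | if z is Some c then (c <= a)%O else True]
      else [set (Some (Order.max a b) : H)]
  end.

Lemma gmax_mulA : associative gmax_mul.
Proof. by move=> [a|] [b|] [c|] //=; rewrite mulgA. Qed.

Lemma gmax_mul1g : left_id (Some 1 : H) gmax_mul.
Proof. by move=> [a|] //=; rewrite mul1g. Qed.

Lemma gmax_mulg1 : right_id (Some 1 : H) gmax_mul.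
Proof. by move=> [a|] //=; rewrite mulg1. Qed.

HB.instance Definition _ :=
  isMonoid.Build H gmax_mulA gmax_mul1g gmax_mulg1.

Let le x y : bool :=
  match x, y with
  | None, _ => true
  | Some _, None => false
  | Some a, Some b => (a <= b)%O
  end.

Let le_refl x : le x x. Proof. by case: x => /=. Qed.

Let le_trans y x z : le x y -> le y z -> le x z.
Proof. by case: x y z => [a|] [b|] [c|] //=; apply: Order.POrderTheory.le_trans. Qed.

Let le_total x y : le x y || le y x.
Proof. by case: x y => [a|] [b|] //=; apply: Order.TotalTheory.le_total. Qed.

Let le_anti x y : le x y -> le y x -> x = y.
Proof.
by case: x y => [a|] [b|] //= h1 h2; congr Some; apply/le_anti; rewrite h1 h2.
Qed.

(* z belongs to the hypersum of x and y iff the maximum of x, y, z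
   is attained at least twice. *)
Let gmax_addE x y z : gmax_add x y z <->
  [\/ x = y /\ le z x, z = x /\ le y x | z = y /\ le x y].
Proof.
case: x y => [a|] [b|] //=.
- case: eqVneq => [<-|ab] /=.
    split=> [|[[_]|[-> _]|[-> _]] //=]; last by case: z.
    by case: z => [c|] /= h; constructor 1.
  split=> [->|].
    by case: (leP a b) => /= h; [constructor 3 | constructor 2]; split=> //; apply: ltW.
  move=> [[[e]]|[-> /= h]|[-> /= h]]; first by rewrite e eqxx in ab.
    by rewrite max_l.
  by rewrite max_r.
- split=> [->|]; first by constructor 2.
  by move=> [[]|[]|[]].
- split=> [->|]; first by constructor 3.
  by move=> [[]|[]|[]].
- split=> [->|]; first by constructor 3.
  by move=> [[_]|[-> _]|[-> _]] //; case: z.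
Qed.

Lemma gmax_add_neq0 x y : gmax_add x y !=set0.
Proof.
have /orP[h|h] := le_total x y.
  by exists y; apply/gmax_addE; constructor 3.
by exists x; apply/gmax_addE; constructor 2.
Qed.

Lemma gmax_addC x y : gmax_add x y = gmax_add y x.
Proof.
by apply/seteqP; split=> z /gmax_addE [[<-]|[-> ?]|[-> ?]];
  move=> *; apply/gmax_addE; [constructor 1|constructor 3|constructor 2|
    constructor 1|constructor 3|constructor 2].
Qed.

Let addA_sub x y z w :
  (exists2 v, gmax_add y z v & gmax_add x v w) ->
  exists2 u, gmax_add x y u & gmax_add u z w.
Proof.
have tot := le_total; have tr := le_trans.
have max1 p q : le p q -> gmax_add p q q by move=> ?; apply/gmax_addE; constructor 3.
have max2 p q : le q p -> gmax_add p q p by move=> ?; apply/gmax_addE; constructor 2.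
have eqp p q : le q p -> gmax_add p p q by move=> ?; apply/gmax_addE; constructor 1.
move=> [v /gmax_addE hv /gmax_addE hw].
case: hv hw => [[<- vy]|[-> zy]|[-> yz]] hw.
- case: hw => [[ev wx]|[-> vx]|[-> xv]].
  + subst v; exists y; first exact: max1.
    by apply: eqp; apply: tr vy.
  + have /orP[xy|yx] := tot x y.
      exists y; first exact: max1.
      exact: eqp.
    exists x; first exact: max2.
    exact: max2.
  + exists y; first by apply: max1; apply: tr vy.
    exact: eqp.
- case: hw => [[-> wx]|[-> yx]|[-> xy]].
  + have /orP[wz|zw] := tot w z.
      exists z; first exact: eqp.
      exact: eqp.
    exists w; first exact: eqp.
    exact: max2.
  + exists x; first exact: max2.
    by apply: max2; apply: tr yx.
  + exists y; first exact: max1.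
    exact: max2.
- case: hw => [[-> wx]|[-> zx]|[-> xz]].
  + exists z; first exact: max2.
    exact: eqp.
  + exists x; first by apply: max2; apply: tr zx.
    exact: max2.
  + have /orP[xy|yx] := tot x y.
      exists y; first exact: max1.
      exact: max1.
    exists x; first exact: max2.
    exact: max1.
Qed.

Lemma gmax_addA x y z :
  set_hyperop gmax_add [set x] (gmax_add y z) =
  set_hyperop gmax_add (gmax_add x y) [set z].
Proof.
apply/seteqP; split=> w.
  move=> [_ -> [v hv hw]].
  have [|u hu hw'] := @addA_sub x y z w; first by exists v.
  by exists u => //; exists z.
move=> [u hu [_ -> hw]].
have [|v hv hw'] := @addA_sub z y x w.
  by exists u; rewrite gmax_addC.
by exists x => //; exists v; rewrite gmax_addC.
Qed.

Lemma gmax_add0 x : gmax_add x None = [set x].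
Proof. by case: x. Qed.

Lemma gmax_add_opp x y : gmax_add x y None <-> y = x.
Proof.
split=> [/gmax_addE [[] //|[]|[]]|->]; last by apply/gmax_addE; constructor 1.
  by move=> <-; case: y.
by move=> <-; case: x.
Qed.

Lemma gmax_add_rev x y z : gmax_add y z x -> gmax_add x y z.
Proof.
move=> /gmax_addE [[<- h]|[-> h]|[-> h]]; apply/gmax_addE.
- by constructor 3.
- by constructor 1.
- by constructor 2.
Qed.

Lemma gmax_mul0 x : gmax_mul None x = None. Proof. by []. Qed.

Lemma gmax_mulr0 x : gmax_mul x None = None. Proof. by case: x. Qed.

Let le_mul2l z x y : le x y -> le (gmax_mul z x) (gmax_mul z y).
Proof.
case: x y z => [a|] [b|] [c|] //=; rewrite le_eqVlt => /predU1P[->//|h].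
by apply/ltW/ltg_mul2l.
Qed.

Let le_mul2r z x y : le x y -> le (gmax_mul x z) (gmax_mul y z).
Proof.
case: x y z => [a|] [b|] [c|] //=; rewrite le_eqVlt => /predU1P[->//|h].
by apply/ltW/ltg_mul2r.
Qed.

Lemma gmax_inv x : x != None ->
  exists y, gmax_mul x y = Some 1 /\ gmax_mul y x = Some 1.
Proof.
by case: x => // a _; exists (Some a^-1); rewrite /= mulgV mulVg.
Qed.

Lemma gmax_mulDr (a x y : H) :
  [set gmax_mul a z | z in gmax_add x y] =
  gmax_add (gmax_mul a x) (gmax_mul a y).
Proof.
have sub (b p q r : H) : gmax_add p q r ->
    gmax_add (gmax_mul b p) (gmax_mul b q) (gmax_mul b r).
  by move=> /gmax_addE [[<- h]|[-> h]|[-> h]]; apply/gmax_addE;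
    [constructor 1|constructor 2|constructor 3]; split=> //; apply: le_mul2l.
apply/seteqP; split=> z; first by move=> [w hw <-]; apply: sub.
case: (eqVneq a None) => [->|/gmax_inv [b [ab ba]]].
  rewrite !gmax_mul0 /= => ->; have [w hw] := gmax_add_neq0 x y.
  by exists w.
move=> /(sub b); rewrite !gmax_mulA ba !gmax_mul1g => h.
by exists (gmax_mul b z) => //; rewrite gmax_mulA ab gmax_mul1g.
Qed.

Lemma gmax_mulDl (a x y : H) :
  [set gmax_mul z a | z in gmax_add x y] =
  gmax_add (gmax_mul x a) (gmax_mul y a).
Proof.
have sub (b p q r : H) : gmax_add p q r ->
    gmax_add (gmax_mul p b) (gmax_mul q b) (gmax_mul r b).
  by move=> /gmax_addE [[<- h]|[-> h]|[-> h]]; apply/gmax_addE;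
    [constructor 1|constructor 2|constructor 3]; split=> //; apply: le_mul2r.
apply/seteqP; split=> z; first by move=> [w hw <-]; apply: sub.
case: (eqVneq a None) => [->|/gmax_inv [b [ab ba]]].
  rewrite !gmax_mulr0 /= => ->; have [w hw] := gmax_add_neq0 x y.
  by exists w => //; rewrite gmax_mulr0.
move=> /(sub b); rewrite -!gmax_mulA ab !gmax_mulg1 => h.
by exists (gmax_mul z b) => //; rewrite -gmax_mulA ba gmax_mulg1.
Qed.

Lemma gmax_one_neq0 : (Some 1 : H) != None. Proof. by []. Qed.

HB.instance Definition _ := @Monoid_isSkewHyperfield.Build H None id gmax_add
  gmax_add_neq0 gmax_addC gmax_addA gmax_add0 gmax_add_opp gmax_add_rev
  gmax_mul0 gmax_mulr0 gmax_mulDr gmax_mulDl gmax_one_neq0 gmax_inv.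

End GammaMax.

(* Main.v *)
Require Import Defs.
From HB Require Import structures.
From mathcomp Require Import boolp classical_sets.
From mathcomp Require Import all_boot all_order.

Set Implicit Arguments.
Unset Strict Implicit.
Unset Printing Implicit Defensive.

Import Order.TTheory.
Local Open Scope group_scope.
Local Open Scope set_scope.

(** Over Gamma_max, orthogonality of V and U says that the maximum of the
    V_e U_e is attained at least twice. So it suffices to find, for every vector V
    and every e in its support, a circuit X with X_e = V_e and X <= V: a covector
    U with V_e U_e the unique maximum would then fail to be orthogonal to X.

    To find X, choose a basis J of the support S of V such that every fundamental
    circuit X of f in S \ J has X_g V_g^-1 maximal at g = f. Such J is obtained by
    adding the elements of S one at a time with at most one exchange each; this
    replaces the maximization of the valuation of J, which is not available when
    Gamma is not abelian. If e is not in J, its fundamental circuit works.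
    Otherwise extend J to a basis B; as V is orthogonal to the fundamental
    cocircuit Y of e in B, some f satisfies V_e <= V_f Y_f, and the fundamental
    circuit of f works.

    All eliminations take place inside sets of nullity 2, where two distinct
    circuits form a modular pair. *)

(** * Matroids given by circuits: bases, exchange and nullity *)

Section CircuitMatroid.
Variables (E : finType) (F : {set {set E}}).
Implicit Types (A B C I J K S : {set E}) (x y : E).

Hypothesis circ_incomp : {in F &, forall A B, A \subset B -> A = B}.
Hypothesis circ_modular_elim : {in F &, forall A B x, modular_pair F A B ->
  x \in A -> x \in B -> exists2 C, C \in F & C \subset (A :|: B) :\ x}.

Local Notation indep := (independent F).

(* If A, B is not a modular pair, a smaller union of two circuits either avoids
   x with one of them, or is handled by the induction hypothesis. *)
Lemma circ_elim A B x : A \in F -> B \in F -> A != B -> x \in A -> x \in B ->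
  exists2 C, C \in F & C \subset (A :|: B) :\ x.
Proof.
move: {2}#|A :|: B|.+1 (ltnSn #|A :|: B|) => n.
elim: n A B => // n IH A B ltn AF BF AB xA xB.
have [mAB|] := boolP (modular_pair F A B); first exact: circ_modular_elim.
rewrite /modular_pair AB /= => /forall_inPn[A' A'F /forall_inPn[B' B'F]].
rewrite negb_imply negbK => /andP[AB' prAB].
have subAB := proper_sub prAB.
have [xA'|xA'] := boolP (x \in A'); last first.
  by exists A' => //; rewrite subsetD1 xA' andbT (subset_trans (subsetUl _ B')).
have [xB'|xB'] := boolP (x \in B'); last first.
  by exists B' => //; rewrite subsetD1 xB' andbT (subset_trans (subsetUr A' _)).
have [|C CF sC] := IH A' B' _ A'F B'F AB' xA' xB'.
  by rewrite -ltnS (leq_trans _ ltn) // ltnS proper_card.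
by exists C => //; apply: subset_trans sC _; apply: setSD.
Qed.

Lemma indepPn I : ~~ indep I -> exists2 C, C \in F & C \subset I.
Proof. by case/forall_inPn => C CF; rewrite negbK => sC; exists C. Qed.

Lemma indep_circF I C : indep I -> C \in F -> C \subset I -> False.
Proof. by move=> /forall_inP h /h /negP. Qed.

Lemma indepS I J : I \subset J -> indep J -> indep I.
Proof.
move=> sIJ iJ; apply: contraT => /indepPn[C CF sC].
by case: (indep_circF iJ CF); apply: subset_trans sC sIJ.
Qed.

Lemma circ_addP I C x : indep I -> C \in F -> C \subset x |: I -> x \in C.
Proof.
move=> iI CF sC; apply: contraT => xC; case: (indep_circF iI CF).
apply/subsetP => y yC; have /setU1P[yx|//] := subsetP sC _ yC.
by rewrite -yx yC in xC.
Qed.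

(** Both circuits contain x, so if they were distinct, eliminating x would leave a circuit inside
    I. *)
Lemma circ_uniq I x A B : indep I -> A \in F -> B \in F ->
  A \subset x |: I -> B \subset x |: I -> A = B.
Proof.
move=> iI AF BF sA sB; apply/eqP/contraT => AB.
have [C CF sC] := circ_elim AF BF AB (circ_addP iI AF sA) (circ_addP iI BF sB).
case: (indep_circF iI CF); apply: subset_trans sC _.
by rewrite subDset subUset sA.
Qed.

Lemma indep_exchange I C x y : indep I -> C \in F -> C \subset x |: I ->
  y \in C -> indep ((x |: I) :\ y).
Proof.
move=> iI CF sC yC; apply: contraT => /indepPn[C' C'F].
rewrite subsetD1 => /andP[sC' yC'].
by rewrite (circ_uniq iI C'F CF sC' sC) yC in yC'.
Qed.

(** Bases of the restriction of the matroid to S, with maximality tested on one-element extensions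
    only. *)
Definition maxindep S J :=
  [&& J \subset S, indep J & [forall x in S :\: J, ~~ indep (x |: J)]].

Lemma maxindep_sub S J : maxindep S J -> J \subset S.
Proof. by case/and3P. Qed.

Lemma maxindep_indep S J : maxindep S J -> indep J.
Proof. by case/and3P. Qed.

Lemma maxindep_circ S J x : maxindep S J -> x \in S -> x \notin J ->
  exists C, [/\ C \in F, C \subset x |: J & x \in C].
Proof.
case/and3P => _ iJ /forall_inP h xS xJ.
have /indepPn[C CF sC] : ~~ indep (x |: J) by apply: h; rewrite inE xJ.
by exists C; split=> //; apply: circ_addP sC.
Qed.

Lemma maxindepP S J : J \subset S -> indep J ->
  (forall x, x \in S -> x \notin J -> ~~ indep (x |: J)) -> maxindep S J.
Proof.
move=> JS iJ h; rewrite /maxindep JS iJ; apply/forall_inP => x.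
by rewrite inE => /andP[xJ xS]; apply: h.
Qed.

Lemma maxindep_exists S I : I \subset S -> indep I ->
  exists2 J, maxindep S J & I \subset J.
Proof.
move=> sI iI.
have [|J /maxsetP[/andP[iJ sJ] mJ] IJ] :=
  @maxset_exists E (fun K => indep K && (K \subset S)) I; first by rewrite iI.
exists J => //; apply: maxindepP => // x xS xJ; apply/negP => ixJ.
have := mJ (x |: J); rewrite ixJ subUset sub1set xS sJ subsetUr => /(_ isT isT) e.
by rewrite -e setU11 in xJ.
Qed.

Lemma basisE B : basis F B = maxindep setT B.
Proof.
apply/idP/idP => [/maxsetP[iB mB]|mB].
  apply: maxindepP => // x _ xB; apply/negP => ixB.
  by move: (setU11 x B); rewrite (mB _ ixB (subsetUr _ _)) (negPf xB).
apply/maxsetP; split=> [|K iK sBK]; first exact: maxindep_indep mB.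
apply/eqP; rewrite eqEsubset sBK andbT; apply/subsetP => x xK.
apply: contraT => xB; have [C [CF sC _]] := maxindep_circ mB (in_setT x) xB.
case: (indep_circF iK CF); apply: subset_trans sC _.
by rewrite subUset sub1set xK.
Qed.

(** For z outside the new set, take the fundamental circuit of z over J. If it contains y,
    eliminating y against C gives a circuit in z added to the new set. *)
Lemma maxindep_exchange S J C x y : maxindep S J -> x \in S -> C \in F ->
  C \subset x |: J -> y \in C -> maxindep S ((x |: J) :\ y).
Proof.
move=> mJ xS CF sC yC; have iJ := maxindep_indep mJ.
apply: maxindepP; [|exact: indep_exchange sC yC|move=> z zS zJ'].
  by apply: subset_trans (subsetDl _ _) _; rewrite subUset sub1set xS maxindep_sub.
have [zy|zy] := eqVneq z y.
  rewrite zy setD1K ?(subsetP sC) //.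
  by apply/negP => /indep_circF; apply; eassumption.
have [xz zJ] : z != x /\ z \notin J.
  by move: zJ'; rewrite !inE zy /= negb_or => /andP.
have [C' [C'F sC' zC']] := maxindep_circ mJ zS zJ.
have xC := circ_addP iJ CF sC.
apply/negP => iz; have [yC'|yC'] := boolP (y \in C'); last first.
  apply: (indep_circF iz C'F); apply/subsetP => w wC'.
  have wy : w != y by apply: contraNneq yC' => <-.
  by have := subsetP sC' _ wC'; rewrite !inE wy => /orP[->|->]; rewrite ?orbT.
have CC' : C != C'.
  apply: contraTneq zC' => <-; apply/negP => /(subsetP sC).
  by rewrite !inE (negPf xz) (negPf zJ).
have [C2 C2F sC2] := circ_elim CF C'F CC' yC yC'.
apply: (indep_circF iz C2F); apply/subsetP => w /(subsetP sC2).
rewrite !inE => /andP[wy /orP[/(subsetP sC)|/(subsetP sC')]]; rewrite !inE wy.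
  by case/orP => ->; rewrite ?orbT.
by case/orP => ->; rewrite ?orbT.
Qed.

Lemma card_exchange J x y : x \notin J -> y \in x |: J -> #|(x |: J) :\ y| = #|J|.
Proof.
by move=> xJ yJ; have := cardsD1 y (x |: J); rewrite cardsU1 yJ xJ !add1n => -[].
Qed.

(** Exchange some x of I outside J for an element y of its fundamental circuit that lies outside I:
    J keeps its size, and the part of I outside J shrinks. *)
Lemma card_maxindep S I J : maxindep S J -> indep I -> I \subset S ->
  (#|I| <= #|J|)%N.
Proof.
move: {2}#|I :\: J|.+1 (ltnSn #|I :\: J|) => n.
elim: n J => // n IH J ltn mJ iI IS.
have [/subset_leq_card //|/subsetPn[x xI xJ]] := boolP (I \subset J).
have xS := subsetP IS _ xI.
have [C [CF sC xC]] := maxindep_circ mJ xS xJ.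
have /subsetPn[y yC yI] : ~~ (C \subset I).
  by apply/negP; apply: indep_circF iI CF.
rewrite -(card_exchange xJ (subsetP sC _ yC)); apply: IH => //; last first.
  exact: maxindep_exchange yC.
rewrite -ltnS (leq_trans _ ltn) // ltnS; apply/proper_card/properP; split.
  apply/subsetP => z; rewrite !inE => /andP[+ zI]; rewrite zI andbT.
  apply: contra => zJ; rewrite zJ orbT andbT.
  by apply: contraNneq yI => <-.
have xy : x != y by apply: contraNneq yI => <-.
by exists x; rewrite !inE ?xI ?xJ // eqxx xy.
Qed.

Lemma eq_card_maxindep S I J : maxindep S I -> maxindep S J -> #|I| = #|J|.
Proof.
move=> mI mJ; apply/eqP; rewrite eqn_leq.
rewrite (card_maxindep mJ (maxindep_indep mI) (maxindep_sub mI)).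
exact: (card_maxindep mI (maxindep_indep mJ) (maxindep_sub mJ)).
Qed.

Lemma indep_card_maxindep S I J : maxindep S J -> indep I -> I \subset S ->
  (#|J| <= #|I|)%N -> maxindep S I.
Proof.
move=> mJ iI IS le; apply: maxindepP => // x xS xI; apply/negP => ixI.
have := card_maxindep mJ ixI; rewrite subUset sub1set xS IS cardsU1 xI.
by move=> /(_ isT); rewrite add1n leqNgt ltnS le.
Qed.

(* The union of A and B has nullity at most 2, hence nullity at most 1 after
   removing an element of A or B, so it then contains at most one circuit. *)
Lemma modular_pair_nullity2 I x y A B : indep I -> A \in F -> B \in F -> A != B ->
  A \subset x |: (y |: I) -> B \subset x |: (y |: I) -> modular_pair F A B.
Proof.
move=> iI AF BF AB sA sB; rewrite /modular_pair AB /=.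
apply/forall_inP => A' A'F; apply/forall_inP => B' B'F.
apply/implyP => AB'; apply/negP => /properP[sAB' [h hAB]].
rewrite inE negb_or => /andP[hA' hB'].
set J := A :|: B in sAB' hAB.
have [C [CF CJ hC]] : exists C, [/\ C \in F, C \subset J & h \in C].
  by case/setUP: hAB => ?; [exists A | exists B]; rewrite ?subsetUl ?subsetUr.
have iCh : indep (C :\ h).
  apply: contraT => /indepPn[C' C'F]; rewrite subsetD1 => /andP[sC' hC'].
  by rewrite (circ_incomp C'F CF sC') hC in hC'.
(* K cannot contain h, as C is dependent. So h is one of the at most two elements of J outside K. *)
have [K mK sCK] := maxindep_exists (subset_trans (subsetDl C [set h]) CJ) iCh.
have hK : h \notin K.
  apply/negP => hK; apply: (indep_circF (maxindep_indep mK) CF).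
  by rewrite -(setD1K hC) subUset sub1set hK.
have JD : J \subset [set x; y] :|: (I :&: J).
  apply/subsetP => z zJ; have : z \in x |: (y |: I).
    by case/setUP: (zJ); [apply: (subsetP sA) | apply: (subsetP sB)].
  by rewrite !in_setU1 in_setU in_set2 in_setI zJ andbT orbA.
have cardJK : (#|J :\: K| <= 2)%N.
  have := card_maxindep mK (indepS (subsetIl I J) iI) (subsetIr I J).
  have := subset_leq_card JD; have := leq_card_setU [set x; y] (I :&: J).
  rewrite -(cardsID K J) (setIidPr (maxindep_sub mK)) => h1 h2 h3.
  have := leq_trans h2 h1; rewrite cards2 => h4.
  rewrite -(leq_add2l #|K|); apply: leq_trans h4 _; rewrite addnC leq_add //.
  by case: eqP.
have [z sJz] : exists z, J :\ h \subset z |: K.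
  have cJ : (#|(J :\: K) :\ h| <= 1)%N.
    by move: cardJK; rewrite (cardsD1 h (J :\: K)) inE hK hAB.
  have [e0|[z zJ]] := set_0Vmem ((J :\: K) :\ h).
    (* Nothing but h lies outside K, so any z would do. *)
    exists h; apply/subsetP => w; rewrite !inE => /andP[wh wJ].
    have := in_set0 w; rewrite -e0 !inE wh wJ /= andbT => /negbFE ->.
    by rewrite orbT.
  exists z; apply/subsetP => w; rewrite !inE => /andP[wh wJ].
  have [wK|wK] := boolP (w \in K); rewrite ?orbT // orbF.
  by apply/eqP/(card_le1_eqP cJ) => //; rewrite !inE wh wK.
have sub C' : C' \subset J -> h \notin C' -> C' \subset z |: K.
  by move=> CJ' hC'; apply: subset_trans sJz; rewrite subsetD1 CJ'.
move: AB'; rewrite (@circ_uniq K z A' B') ?eqxx ?(maxindep_indep mK) //.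
  by apply: sub => //; apply: subset_trans sAB'; apply: subsetUl.
by apply: sub => //; apply: subset_trans sAB'; apply: subsetUr.
Qed.
End CircuitMatroid.

(** * Iterated hypersums *)

Section HyperSums.
Variable H : skewHyperfieldType.
Local Notation hsum := (set_hyperop (@hadd H)).
Local Open Scope classical_set_scope.

Lemma hsumA : associative hsum.
Proof.
move=> A B C; apply/seteqP; split=> w.
  move=> [a Aa [v [b Bb [c Cc hv]] hw]].
  have : hsum (hadd a b) [set c] w.
    by rewrite -haddA; exists a => //; exists v.
  move=> [u hu [_ -> hw']]; exists u; last by exists c.
  by exists a => //; exists b.
move=> [v [a Aa [b Bb hv]] [c Cc hw]].
have : hsum [set a] (hadd b c) w by rewrite haddA; exists v => //; exists c.
move=> [_ -> [u hu hw']]; exists a => //; exists u => //.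
by exists b => //; exists c.
Qed.

Lemma hsumC : commutative hsum.
Proof.
by move=> A B; apply/seteqP; split=> w [a Aa [b Bb hw]];
  exists b => //; exists a; rewrite // haddC.
Qed.

Lemma hsum0 : left_id [set hzero] hsum.
Proof.
move=> A; apply/seteqP; split=> w.
  by move=> [_ -> [a Aa]]; rewrite haddC hadd0 => ->.
by move=> Aw; exists hzero => //; exists w; rewrite // haddC hadd0.
Qed.

(** This lets [bigD1] isolate any summand of the hypersum in [orthogonal]. *)
HB.instance Definition _ :=
  Monoid.isComLaw.Build (set H) [set hzero] hsum hsumA hsumC hsum0.

End HyperSums.

(** * Order and hyperaddition on [Gamma_max] *)

Section GammaMaxOrder.
Variables (d : Order.disp_t) (G : orderedGroupType d).
Local Notation H := (Gamma_max G).
Implicit Types x y z m : H.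

Definition gle x y : bool :=
  match x, y with
  | None, _ => true
  | Some _, None => false
  | Some a, Some b => (a <= b)%O
  end.

Definition ginv x : H := if x is Some a then Some a^-1 else None.

Lemma gle_refl x : gle x x. Proof. by case: x => /=. Qed.

Lemma gle_trans y x z : gle x y -> gle y z -> gle x z.
Proof. by case: x y z => [a|] [b|] [c|] //=; apply: le_trans. Qed.

Lemma gle_total x y : gle x y || gle y x.
Proof. by case: x y => [a|] [b|] //=; apply: le_total. Qed.

Lemma gle_anti x y : gle x y -> gle y x -> x = y.
Proof.
by case: x y => [a|] [b|] //= h1 h2; congr Some; apply/le_anti; rewrite h1 h2.
Qed.

Lemma gle0 x : gle hzero x. Proof. by case: x. Qed.

Lemma gle_neq0 x y : gle x y -> x != hzero -> y != hzero.
Proof. by case: x y => [a|] [b|]. Qed.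

Lemma gle_mul2l z x y : gle x y -> gle (z * x) (z * y).
Proof.
case: x y z => [a|] [b|] [c|] //=; rewrite le_eqVlt => /predU1P[->//|h].
by apply/ltW/ltg_mul2l.
Qed.

Lemma gle_mul2r z x y : gle x y -> gle (x * z) (y * z).
Proof.
case: x y z => [a|] [b|] [c|] //=; rewrite le_eqVlt => /predU1P[->//|h].
by apply/ltW/ltg_mul2r.
Qed.

Lemma gmulV x : x != hzero -> x * ginv x = 1.
Proof. by case: x => // a _; congr Some; rewrite mulgV. Qed.

Lemma gmulVx x : x != hzero -> ginv x * x = 1.
Proof. by case: x => // a _; congr Some; rewrite mulVg. Qed.

Lemma ginv_neq0 x : x != hzero -> ginv x != hzero.
Proof. by case: x. Qed.

Lemma gmul_neq0 x y : (x * y != hzero) = (x != hzero) && (y != hzero).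
Proof. by case: x y => [a|] [b|]. Qed.

Lemma gmul0 x : hzero * x = hzero. Proof. exact: hmul0. Qed.
Lemma gmulr0 x : x * hzero = hzero. Proof. exact: hmulr0. Qed.

(** The three cases say which two of x, y, z attain the common maximum. *)
Lemma haddP x y z : hadd x y z <->
  [\/ x = y /\ gle z x, z = x /\ gle y x | z = y /\ gle x y].
Proof.
case: x y => [a|] [b|] //=.
- rewrite /hadd /=; case: eqVneq => [<-|ab] /=.
    split=> [|[[_]|[-> _]|[-> _]] //=]; last by case: z.
    by case: z => [c|] /= h; constructor 1.
  split=> [->|].
    by case: (leP a b) => /= h; [constructor 3 | constructor 2]; split=> //; apply: ltW.
  move=> [[[e]]|[-> /= h]|[-> /= h]]; first by rewrite e eqxx in ab.
    by rewrite max_l.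
  by rewrite max_r.
- split=> [->|]; first by constructor 2.
  by move=> [[]|[]|[]].
- split=> [->|]; first by constructor 3.
  by move=> [[]|[]|[]].
- split=> [->|]; first by constructor 3.
  by move=> [[_]|[-> _]|[-> _]] //; case: z.
Qed.

Lemma hadd_le m x y z : hadd x y z -> gle x m -> gle y m -> gle z m.
Proof. by move=> /haddP[[_ zx]|[-> _]|[-> _]] // xm _; apply: gle_trans xm. Qed.

Lemma hadd_ge x y z : hadd x y z -> gle x y \/ gle x z.
Proof.
move=> /haddP[[-> _]|[-> _]|[-> xy]]; [left|right|left] => //; exact: gle_refl.
Qed.

Lemma haddx0 x z : hadd x hzero z -> z = x.
Proof. by rewrite hadd0. Qed.

Lemma hadd0x x z : hadd hzero x z -> z = x.
Proof. by rewrite haddC hadd0. Qed.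

Lemma gmax_exists (I : finType) (P : pred I) (a : I -> H) i : P i ->
  exists2 j, P j & forall k, P k -> gle (a k) (a j).
Proof.
move=> Pi; have [|||j Pj h] := @extremumP _ _ (fun x y => gle y x) i P a _ _ _ Pi.
- exact: gle_refl.
- by move=> x y z yx zy; apply: gle_trans zy yx.
- by move=> x y; apply: gle_total.
- by exists j.
Qed.

End GammaMaxOrder.

(** * Orthogonality as a maximum attained twice *)

Section GammaMaxOrthogonal.
Variables (d : Order.disp_t) (G : orderedGroupType d) (E : finType).
Local Notation H := (Gamma_max G).
Implicit Types X Y : {ffun E -> H}.

(** Stating that every nonzero term is dominated by another one avoids naming the maximum. *)
Lemma orthogonalP X Y : orthogonal X Y <->
  forall e, X e * Y e != hzero -> exists2 f, f != e & gle (X e * Y e) (X f * Y f).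
Proof.
rewrite /orthogonal; split=> [+ e ne0|h].
  rewrite (bigD1 e) //= => -[_ -> [w sw hw]].
  apply: contrapT => nex.
  have: ~~ gle (X e * Y e) w.
    (* Elements strictly below the term at e have all their hypersums strictly below it. *)
    move: w sw {hw}; apply: (big_ind (fun A : set H => forall w, A w -> ~~ gle (X e * Y e) w)).
    - by move=> _ ->; apply: contra ne0 => /gle_anti -> //; apply: gle0.
    - move=> A B hA hB w [a /hA Aa [b /hB Bb /hadd_le hw]].
      have /orP[ab|ba] := gle_total a b.
        by apply: contra Bb => /gle_trans; apply; apply: hw => //; apply: gle_refl.
      by apply: contra Aa => /gle_trans; apply; apply: hw => //; apply: gle_refl.
    - by move=> f fe _ ->; apply/negP => ?; apply: nex; exists f.
  move=> /negP; apply.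
  case/haddP: hw => [[<- _]|[e0 _]|[_ //]]; first exact: gle_refl.
  by rewrite -e0 eqxx in ne0.
have [e0|/forallPn[e1 ne1]] := boolP [forall e, X e * Y e == hzero].
  rewrite big1 // => e _; by rewrite (eqP (forallP e0 e)).
have [e [ne0 emax]] : exists e, X e * Y e != hzero /\ forall f, gle (X f * Y f) (X e * Y e).
  have [e ne0 he] := gmax_exists (P := fun e => X e * Y e != hzero) (fun e => X e * Y e) ne1.
  exists e; split=> // f; have [->|] := eqVneq (X f * Y f) hzero; first exact: gle0.
  exact: he.
have [f fe ef] := h e ne0.
have eqef : X f * Y f = X e * Y e by apply: gle_anti.
rewrite (bigD1 e) //= (bigD1 f) //= eqef.
set A := bigop.body _ _ _.
have [w Aw we] : exists2 w, A w & gle w (X e * Y e).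
  rewrite /A; apply: (big_ind (fun A : set H => exists2 w, A w & gle w (X e * Y e))).
  - by exists hzero => //; apply: gle0.
  - move=> B C [b Bb be] [c Cc ce]; have [z hz] := hadd_neq0 b c.
    by exists z; [exists b => //; exists c | apply: hadd_le hz be ce].
  - by move=> g _; exists (X g * Y g).
(* With t the common value at e and f, t lies in the hypersum of t and w because w is at most t, and
   0 lies in the hypersum of t and t. *)
exists (X e * Y e) => //; exists (X e * Y e).
  exists (X e * Y e) => //; exists w => //; apply/haddP; constructor 2; split=> //.
by apply/haddP; constructor 1; split=> //; apply: gle0.
Qed.
End GammaMaxOrthogonal.

(** * Scaling and elimination of circuits over [Gamma_max] *)

Section GammaMaxMatroid.
Variables (d : Order.disp_t) (G : orderedGroupType d) (E : finType).
Local Notation H := (Gamma_max G).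
Variable M : left_matroid H E.
Implicit Types (X Y Z V U : {ffun E -> H}) (A B C D I J K S : {set E}) (e f g x y : E).

Local Notation F := (supports (circuits M)).
Local Notation circ := (circuits M).
Local Notation indep := (independent F).

Lemma in_supp X e : (e \in supp X) = (X e != hzero).
Proof. by rewrite inE. Qed.

Lemma supp_subF X S e : supp X \subset S -> e \notin S -> X e = hzero.
Proof.
move=> sX; apply: contraNeq; rewrite -in_supp; exact: (subsetP sX).
Qed.

Lemma supp_scale X (a : H) : a != hzero -> supp [ffun e => a * X e] = supp X.
Proof. by move=> a0; apply/setP => e; rewrite !in_supp ffunE gmul_neq0 a0. Qed.

Lemma supportsP S : reflect (exists2 X, circ X & supp X = S) (S \in F).
Proof. by rewrite inE; apply: asboolP. Qed.

Lemma supp_circ X : circ X -> supp X \in F.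
Proof. by move=> cX; apply/supportsP; exists X. Qed.

Lemma supports_incomp : {in F &, forall A B, A \subset B -> A = B}.
Proof.
move=> _ _ /supportsP[X cX <-] /supportsP[Y cY <-] sXY.
have [a a0 ->] := circuit_incomparable cX cY sXY.
by rewrite supp_scale.
Qed.

Lemma scale_to X Y e : circ X -> X e != hzero -> Y e != hzero ->
  exists2 a : H, a * X e = Y e & circ [ffun f => a * X f].
Proof.
move=> cX Xe Ye; exists (Y e * ginv (X e)).
  by rewrite -mulgA gmulVx // mulg1.
by apply: circuit_scale => //; rewrite gmul_neq0 Ye ginv_neq0.
Qed.

(** Since [hopp] is the identity on [Gamma_max], the elimination axiom applies once Y is scaled to
    agree with X at e. *)
Lemma hyper_modular_elim X Y e : circ X -> circ Y ->
  modular_pair F (supp X) (supp Y) -> X e != hzero -> Y e != hzero ->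
  exists (a : H) Z, [/\ a * Y e = X e, circ Z,
    supp Z \subset (supp X :|: supp Y) :\ e & forall f, hadd (X f) (a * Y f) (Z f)].
Proof.
move=> cX cY mXY Xe Ye; have [a aY caY] := scale_to cY Ye Xe.
have a0 : a != hzero by move: Xe; rewrite -aY gmul_neq0 => /andP[].
have [|||Z [cZ Ze hZ]] := circuit_modular_elim (e := e) cX caY; rewrite ?ffunE ?aY //.
  by rewrite supp_scale.
exists a, Z; split=> // [|f]; last by have := hZ f; rewrite ffunE.
apply/subsetP => f; rewrite !inE => Zf; apply/andP; split.
  by apply: contraNneq Zf => ->; rewrite Ze.
move: Zf; apply: contraNT; rewrite negb_or !negbK => /andP[/eqP Xf /eqP Yf].
by have := hZ f; rewrite ffunE Xf Yf gmulr0 => /haddx0 ->.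
Qed.

Lemma supports_modular_elim : {in F &, forall A B x, modular_pair F A B ->
  x \in A -> x \in B -> exists2 C, C \in F & C \subset (A :|: B) :\ x}.
Proof.
move=> _ _ /supportsP[X cX <-] /supportsP[Y cY <-] e mXY.
rewrite !in_supp => Xe Ye.
have [a [Z [_ cZ sZ _]]] := hyper_modular_elim cX cY mXY Xe Ye.
by exists (supp Z) => //; apply: supp_circ.
Qed.

Local Notation elimF := supports_modular_elim.

Lemma hyper_elim I x y X Y e : indep I -> circ X -> circ Y -> supp X != supp Y ->
  supp X \subset x |: (y |: I) -> supp Y \subset x |: (y |: I) ->
  X e != hzero -> Y e != hzero ->
  exists (a : H) Z, [/\ a * Y e = X e, circ Z,
    supp Z \subset (supp X :|: supp Y) :\ e & forall f, hadd (X f) (a * Y f) (Z f)].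
Proof.
move=> iI cX cY XY sX sY; apply: hyper_modular_elim => //.
by apply: (modular_pair_nullity2 supports_incomp elimF iI) sX sY => //; apply: supp_circ.
Qed.

(** By [circ_uniq] both circuits have the same support, and circuits with equal supports are left
    multiples of each other. *)
Lemma circ_proportional I x X Z : indep I -> circ X -> circ Z ->
  supp X \subset x |: I -> supp Z \subset x |: I ->
  exists a : H, forall f, X f = a * Z f.
Proof.
move=> iI cX cZ sX sZ.
have eXZ := circ_uniq elimF iI (supp_circ cX) (supp_circ cZ) sX sZ.
have [|a _ ->] := circuit_incomparable cZ cX; first by rewrite eXZ.
by exists a => f; rewrite ffunE.
Qed.

Lemma maxindep_hcirc S J x : maxindep F S J -> x \in S -> x \notin J ->
  exists2 X, circ X & supp X \subset x |: J.
Proof.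
move=> mJ xS xJ; have [_ [/supportsP[X cX <-] sX _]] := maxindep_circ mJ xS xJ.
by exists X.
Qed.

Lemma circ_add_neq0 I X x : indep I -> circ X -> supp X \subset x |: I -> X x != hzero.
Proof. by move=> iI cX sX; rewrite -in_supp; apply: circ_addP iI (supp_circ cX) sX. Qed.

Lemma indep0 : indep set0.
Proof.
apply: contraT => /indepPn[_ /supportsP[X cX <-]]; rewrite subset0 => /eqP X0.
case: (circuit_neq0 (l := M)); suff <- : X = [ffun => hzero] by [].
by apply/ffunP => e; rewrite ffunE; apply: (@supp_subF _ set0); rewrite ?X0 ?inE.
Qed.

(** * Bases that are optimal for a weight *)

(** The weight multiplies on the right, so the condition is unaffected by left scaling of X. It is
    used with the entrywise inverse of a vector. *)
Definition optimal_basis (W : E -> H) S J := maxindep F S J /\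
  forall X f, circ X -> f \in S -> f \notin J -> supp X \subset f |: J ->
    forall g, gle (X g * W g) (X f * W f).

(* When s is added to S and its fundamental circuit X0 with respect to J is
   maximal at g rather than s, exchanging g for s restores optimality. *)
Lemma optimal_basis_exists W S : exists J, optimal_basis W S J.
Proof.
move: {2}#|S| (erefl #|S|) => n; elim: n S => [|n IH] S.
  move/eqP; rewrite cards_eq0 => /eqP->; exists set0; split=> [|X f _].
    by apply: maxindepP => // [|x]; [exact: indep0 | rewrite inE].
  by rewrite inE.
move=> cS; have /set0Pn[s sS] : S != set0 by rewrite -cards_eq0 cS.
have [|J [mJ oJ]] := IH (S :\ s); first by move: cS; rewrite (cardsD1 s) sS => -[].
have iJ := maxindep_indep mJ.
have JS : J \subset S by apply: subset_trans (maxindep_sub mJ) (subsetDl _ _).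
have sJ : s \notin J by apply/negP => /(subsetP (maxindep_sub mJ)); rewrite !inE eqxx.
have [isJ|dsJ] := boolP (indep (s |: J)).
  (* Here the fundamental circuits over [s |: J] are those over J. *)
  exists (s |: J); split.
    apply: maxindepP => // [|x xS]; first by rewrite subUset sub1set sS.
    rewrite !inE negb_or => /andP[xs xJ].
    have [|X cX sX] := maxindep_hcirc (x := x) mJ _ xJ; first by rewrite !inE xs.
    apply/negP => ix; apply: (indep_circF ix (supp_circ cX)).
    by apply: subset_trans sX _; rewrite setUCA subsetUr.
  move=> X f cX fS; rewrite !inE negb_or => /andP[fs fJ] sX.
  have fS' : f \in S :\ s by rewrite !inE fs.
  have [P cP sP] := maxindep_hcirc mJ fS' fJ.
  apply: oJ => //; rewrite (circ_uniq elimF isJ (supp_circ cX) (supp_circ cP) sX) //.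
  by apply: subset_trans sP _; rewrite setUCA subsetUr.
have [_ /supportsP[X0 cX0 <-] sX0] := indepPn dsJ.
have X0s := circ_add_neq0 iJ cX0 sX0.
have [g gX0 gmax] := gmax_exists (P := fun e => e \in supp X0) (fun e => X0 e * W e)
  (etrans (in_supp _ _) X0s).
have {}gmax f : gle (X0 f * W f) (X0 g * W g).
  have [/gmax //|] := boolP (f \in supp X0); rewrite in_supp negbK => /eqP->.
  by rewrite gmul0 gle0.
have gmaxS X : circ X -> supp X \subset s |: J -> forall f, gle (X f * W f) (X g * W g).
  move=> cX sX f; have [a aX] := circ_proportional iJ cX cX0 sX sX0.
  by rewrite !aX -!mulgA; apply: gle_mul2l.
have mJS : maxindep F S ((s |: J) :\ s).
  rewrite setU1K //; apply: maxindepP => // x xS xJ.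
  have [-> //|xs] := eqVneq x s.
  have [|X cX sX] := maxindep_hcirc (x := x) mJ _ xJ; first by rewrite !inE xs.
  by apply/negP => ix; apply: (indep_circF ix (supp_circ cX)).
rewrite setU1K // in mJS.
exists ((s |: J) :\ g); split.
  exact: (maxindep_exchange elimF mJS sS (supp_circ cX0) sX0 gX0).
have iJ' := indep_exchange elimF iJ (supp_circ cX0) sX0 gX0.
move=> X f cX fS fJ' sX.
have [fg|fg] := eqVneq f g.
  rewrite fg; apply: gmaxS => //; apply: subset_trans sX _.
  by rewrite fg setD1K // (subsetP sX0).
have [fs fJ] : f != s /\ f \notin J.
  by move: fJ'; rewrite !inE fg /= negb_or => /andP.
have fS' : f \in S :\ s by rewrite !inE fs.
have X0f : X0 f = hzero by apply: supp_subF sX0 _; rewrite !inE negb_or fs.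
have [P cP sP] := maxindep_hcirc mJ fS' fJ.
have sub Z : supp Z \subset (f |: (s |: J)) :\ g -> supp Z \subset f |: (s |: J) :\ g.
  move=> sZ; apply: subset_trans sZ _; apply/subsetP => h; rewrite !inE.
  by move=> /andP[->] /=.
have sP' : supp P \subset f |: (s |: J) by apply: subset_trans sP _; rewrite setUCA subsetUr.
have [Pg|Pg] := eqVneq (P g) hzero.
  have [a aX] : exists a, forall f, X f = a * P f.
    apply: circ_proportional iJ' cX cP sX _; apply: sub.
    by rewrite subsetD1 sP' in_supp Pg eqxx.
  by move=> h; rewrite !aX -!mulgA; apply/gle_mul2l/oJ.
have sX0' : supp X0 \subset f |: (s |: J) by apply: subset_trans sX0 (subsetUr _ _).
have Pf := circ_add_neq0 iJ cP sP.
have PX0 : supp P != supp X0.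
  by apply: contraNneq Pf => eP; rewrite -[_ == _]negbK -in_supp eP in_supp X0f eqxx.
(* Z is a fundamental circuit of f over the new basis, with Z_f = P_f. The terms a X0_h W_h are at
   most a X0_g W_g = P_g W_g, hence at most P_f W_f. *)
have [a [Z [aX0 cZ sZ hZ]]] := hyper_elim (e := g) iJ cP cX0 PX0 sP' sX0' Pg
  (etrans (esym (in_supp _ _)) gX0).
have [b bX] : exists b, forall f, X f = b * Z f.
  apply: circ_proportional iJ' cX cZ sX _; apply: sub.
  by apply: subset_trans sZ _; apply: setSD; rewrite subUset sP'.
move=> h; rewrite !bX -!mulgA; apply: gle_mul2l.
have := hZ f; rewrite X0f gmulr0 => /haddx0 ->.
have hW : hadd (P h * W h) (a * X0 h * W h) (Z h * W h).
  by rewrite -hmulDl; exists (Z h).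
apply: hadd_le hW _ _; first exact: oJ.
apply: (@gle_trans _ _ (P g * W g)); last exact: oJ.
by rewrite -aX0 -!mulgA; apply: gle_mul2l.
Qed.

(** * Cocircuits and bases of hyperplanes *)

(** For nonempty D, this makes the complement of D a hyperplane with basis K. *)
Definition hyperplane_basis D K := maxindep F (~: D) K /\
  forall f, f \in D -> maxindep F setT (f |: K).

(** If f were dependent on K', then K' would be maximal independent in [f |: ~: D], yet smaller than
    the independent set [f |: K]. *)
Lemma hyperplane_basis_change D K K' :
  hyperplane_basis D K -> maxindep F (~: D) K' -> hyperplane_basis D K'.
Proof.
move=> [mK bK] mK'; split=> // f fD.
have cK := eq_card_maxindep elimF mK' mK.
have fK J : maxindep F (~: D) J -> f \notin J.
  by move=> mJ; apply/negP => /(subsetP (maxindep_sub mJ)); rewrite inE fD.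
have cfK : #|f |: K'| = #|f |: K| by rewrite !cardsU1 !fK ?cK.
apply: (indep_card_maxindep elimF (bK f fD)); rewrite ?subsetT ?cfK //.
apply: contraT => dK'.
have mf : maxindep F (f |: ~: D) K'.
  have KD : K' \subset f |: ~: D by apply: subset_trans (maxindep_sub mK') (subsetUr _ _).
  apply: (maxindepP KD (maxindep_indep mK')) => x.
  case/setU1P => [-> //|xD xK']; have [C [CF sC _]] := maxindep_circ mK' xD xK'.
  by apply/negP => ix; apply: indep_circF ix CF sC.
have := card_maxindep elimF mf (maxindep_indep (bK f fD)).
by rewrite setUS ?(maxindep_sub mK) // cardsU1 fK // cK add1n ltnn => /(_ isT).
Qed.

Lemma hyperplane_circ D K f g : hyperplane_basis D K -> f \in D -> g \in D -> f != g ->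
  exists2 P, circ P & supp P \subset f |: (g |: K).
Proof.
move=> [mK bK] fD gD fg; apply: maxindep_hcirc (bK g gD) (in_setT f) _.
rewrite !inE negb_or fg; apply/negP => /(subsetP (maxindep_sub mK)).
by rewrite inE fD.
Qed.

(** Orthogonality of Y to the circuits meeting its support in two elements, required only for
    circuits that otherwise stay in one fixed K. *)
Definition adapted Y K := hyperplane_basis (supp Y) K /\
  forall X f g, circ X -> f \in supp Y -> g \in supp Y -> f != g ->
    supp X \subset f |: (g |: K) -> X f * Y f = X g * Y g.

(** A circuit for the new K arises from one for the old K by eliminating b, if needed, against a
    circuit with support C. As C is disjoint from the support of Y, the entries there do not
    change. *)
Lemma adapted_exchange Y K C c b : adapted Y K -> c \notin supp Y -> c \notin K ->
  C \in F -> C \subset c |: K -> b \in C -> adapted Y ((c |: K) :\ b).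
Proof.
set D := supp Y; set K' := _ :\ b.
move=> [hK aK] cD cK CF sC bC.
have hK' : hyperplane_basis D K'.
  apply: hyperplane_basis_change (hK) _.
  by apply: (maxindep_exchange elimF hK.1) bC; rewrite // inE.
split=> // X f g cX fD gD fg sX.
have [P cP sP] := hyperplane_circ hK fD gD fg.
have notinC h : h \in D -> h \notin C.
  move=> hD; apply/negP => /(subsetP sC)/setU1P[hc|].
    by rewrite hc (negPf cD) in hD.
  by move=> /(subsetP (maxindep_sub hK.1)); rewrite inE hD.
have sub Z : supp Z \subset (f |: (c |: (g |: K))) :\ b -> supp Z \subset f |: (g |: K').
  move=> sZ; apply: subset_trans sZ _; apply/subsetP => h; rewrite /K' !inE.
  by move=> /andP[->] /=; rewrite (orbCA (h == c)).
have sP' : supp P \subset f |: (c |: (g |: K)).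
  by apply: subset_trans sP _; rewrite setUS // subsetUr.
have iK' := maxindep_indep (hK'.2 g gD).
have [Pb|Pb] := eqVneq (P b) hzero.
  have [a aX] : exists a, forall f, X f = a * P f.
    apply: circ_proportional iK' cX cP sX _; apply: sub.
    by rewrite subsetD1 sP' in_supp Pb eqxx.
  by rewrite !aX -!mulgA (aK P f g).
case/supportsP: (CF) => R cR eR.
have sR : supp R \subset f |: (c |: (g |: K)).
  by rewrite eR; apply: subset_trans sC _; rewrite setUCA setUS // setUA subsetUr.
have Rb : R b != hzero by rewrite -in_supp eR.
have Pf := circ_add_neq0 (maxindep_indep (hK.2 g gD)) cP sP.
have PR : supp P != supp R.
  by apply: contraTneq Pf => eP; rewrite -in_supp eP eR notinC.
have [a [Z [_ cZ sZ hZ]]] :=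
  hyper_elim (maxindep_indep (hK.2 g gD)) cP cR PR sP' sR Pb Rb.
have [l lX] : exists l, forall f, X f = l * Z f.
  apply: circ_proportional iK' cX cZ sX _; apply: sub.
  by apply: subset_trans sZ _; apply: setSD; rewrite subUset sP'.
have ZP h : h \in D -> Z h = P h.
  move=> hD; have := hZ h; rewrite (@supp_subF R C) ?eR ?notinC // gmulr0.
  exact: haddx0.
by rewrite !lX !ZP // -!mulgA (aK P f g).
Qed.

(** Exchanges move K until the support of X lies in D and K together. X then meets D in two or three
    elements; two are covered by adaptedness, and three reduce to two by an elimination. *)
Lemma adapted_orthogonal Y K X : adapted Y K -> circ X ->
  (#|supp X :&: supp Y| <= 3)%N -> orthogonal X Y.
Proof.
set D := supp Y => aK cX cXD.
have [dXD|/set0Pn[e0 /setIP[e0X e0D]]] := eqVneq (supp X :&: D) set0.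
  apply/orthogonalP => e; rewrite gmul_neq0 -!in_supp => XYe.
  by have := in_set0 e; rewrite -dXD inE XYe.
move: {2}#|supp X :\: (D :|: K)| (erefl #|supp X :\: (D :|: K)|) => n.
elim: n K aK => [|n IH] K aK; last first.
  move=> cn; have /set0Pn[c] : supp X :\: (D :|: K) != set0 by rewrite -cards_eq0 cn.
  rewrite in_setD in_setU negb_or => /andP[/andP[cD cK] cX'].
  have [|C [CF sC cC]] := maxindep_circ (x := c) aK.1.1 _ cK; first by rewrite inE.
  (* Otherwise C would equal the support of X, which meets D while C does not. *)
  have /subsetPn[b bC bX] : ~~ (C \subset supp X).
    apply/negP => CX; have eC := supports_incomp CF (supp_circ cX) CX.
    have := e0X; rewrite -eC => /(subsetP sC)/setU1P[ec|].
      by rewrite ec (negPf cD) in e0D.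
    by move/(subsetP (maxindep_sub aK.1.1)); rewrite inE e0D.
  apply: IH (adapted_exchange aK cD cK CF sC bC) _.
  have -> : supp X :\: (D :|: (c |: K) :\ b) = (supp X :\: (D :|: K)) :\ c.
    apply/setP => z; rewrite !in_setD !in_setU !in_setD !in_set1 in_setU1.
    have [zX|] := boolP (z \in supp X); last by rewrite !andbF.
    have -> : z != b by apply: contraNneq bX => <-.
    by rewrite !andbT /= orbCA negb_or.
  by move: cn; rewrite (cardsD1 c) in_setD in_setU negb_or cD cK cX' add1n; case.
move/eqP; rewrite cards_eq0 setD_eq0 => sX.
have [hK rK] := aK.
have sub (T : {set E}) : supp X :&: D \subset T -> supp X \subset T :|: K.
  move=> sT; apply/subsetP => z zX; rewrite inE orbC; apply/orP.
  have /setUP[zD|] := subsetP sX _ zX; last by left.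
  by right; apply: (subsetP sT); rewrite inE zX.
apply/orthogonalP => e; rewrite gmul_neq0 -!in_supp => /andP[eX eD].
have eT : e \in supp X :&: D by rewrite inE eX.
have [T1|/set0Pn[f]] := eqVneq ((supp X :&: D) :\ e) set0.
  case: (indep_circF (maxindep_indep (hK.2 e eD)) (supp_circ cX)).
  by apply: sub; rewrite -setD_eq0 T1.
rewrite in_setD1 => /andP[fe fT]; have /setIP[fX fD] := fT.
have [T2|/set0Pn[g]] := eqVneq (((supp X :&: D) :\ e) :\ f) set0.
  exists f => //; rewrite (rK X e f) ?gle_refl // 1?eq_sym // setUA.
  by apply: sub; rewrite -setD_eq0 -setDDl T2.
rewrite !in_setD1 => /and3P[gf ge gT]; have /setIP[gX gD] := gT.
have T3 : supp X :&: D = [set g; f; e].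
  apply/esym/eqP; rewrite eqEcard !subUset !sub1set gT fT eT /=.
  by rewrite setUC cardsU1 cards2 !inE gf negb_or (eq_sym e) ge (eq_sym e) fe.
have sX3 : supp X \subset g |: (f |: (e |: K)) by rewrite !setUA; apply: sub; rewrite T3.
have [P cP sP] := hyperplane_circ hK fD eD fe.
have iK := maxindep_indep (hK.2 e eD).
have gP : g \notin f |: (e |: K).
  rewrite !inE (negPf gf) (negPf ge) /=; apply/negP.
  by move=> /(subsetP (maxindep_sub hK.1)); rewrite inE gD.
have sP' : supp P \subset g |: (f |: (e |: K)) by apply: subset_trans sP (subsetUr _ _).
have XP : supp X != supp P.
  by apply: contraNneq gP => eXP; apply: (subsetP sP); rewrite -eXP.
have Pf := circ_add_neq0 iK cP sP.
have [a [Z [aP cZ sZ hZ]]] :=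
  hyper_elim iK cX cP XP sX3 sP' (etrans (esym (in_supp _ _)) fX) Pf.
have sZ' : supp Z \subset g |: (e |: K).
  apply: subset_trans sZ _; apply/subsetP => z /setD1P[zf /setUP[]].
    by move=> /(subsetP sX3); rewrite !in_setU1 (negPf zf).
  by move=> /(subsetP sP'); rewrite !in_setU1 (negPf zf).
have Zg : Z g = X g by have := hZ g; rewrite (supp_subF sP gP) gmulr0; apply: haddx0.
(* Multiply the elimination at e by Y_e: adaptedness for P turns a P_e Y_e into X_f Y_f, and for Z
   it turns Z_e Y_e into X_g Y_g. *)
have : hadd (X e * Y e) (X f * Y f) (X g * Y g).
  have -> : X f * Y f = a * P e * Y e by rewrite -aP -!mulgA (rK P f e).
  rewrite -Zg (rK Z g e) // -hmulDl; exists (Z e) => //; exact: hZ.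
by case/hadd_ge => h; [exists f | exists g].
Qed.

(** * Fundamental cocircuits and the domination of a circuit by a vector *)

(** The last condition forces Y_f to be the product of the inverse of X_f with X_e, in which left
    scalars of X cancel. This Y is adapted to B without e, which yields the required
    orthogonality. *)
Lemma fundamental_cocircuit B e : maxindep F setT B -> e \in B ->
  exists Y, [/\ cocircuits M Y, Y e = 1, forall b, b \in B -> b != e -> Y b = hzero
    & forall X f, circ X -> f \notin B -> supp X \subset f |: B -> X f * Y f = X e].
Proof.
move=> mB eB; have iB := maxindep_indep mB.
have /choice[Yf YfP] : forall f, exists y : H,
    [/\ f = e -> y = 1, f \in B -> f != e -> y = hzero
      & forall X, circ X -> f \notin B -> supp X \subset f |: B -> X f * y = X e].
  move=> f.
  have [->|fe] := eqVneq f e; first by exists 1; split=> //; rewrite eB.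
  have [fB|fB] := boolP (f \in B); first by exists hzero; split=> // /eqP; rewrite (negPf fe).
  have [P cP sP] := maxindep_hcirc mB (in_setT f) fB.
  exists (ginv (P f) * P e); split=> // [/eqP|X cX _ sX]; first by rewrite (negPf fe).
  have [a aX] := circ_proportional iB cX cP sX sP.
  by rewrite !aX -mulgA (mulgA (P f)) gmulV ?mul1g // (circ_add_neq0 iB).
pose Y : {ffun E -> H} := finfun Yf.
have Ye : Y e = 1 by rewrite ffunE; have [->] := YfP e.
have Y0 b : b \in B -> b != e -> Y b = hzero by move=> bB be; rewrite ffunE; have [_ ->] := YfP b.
have YX X f : circ X -> f \notin B -> supp X \subset f |: B -> X f * Y f = X e.
  by move=> cX fB sX; rewrite ffunE; have [_ _ ->] := YfP f.
exists Y; split=> //.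
set D := supp Y; set K := B :\ e.
have eD : e \in D by rewrite in_supp Ye.
have BK : e |: K = B by rewrite setD1K.
have DB f : f \in D -> f != e -> f \notin B.
  by rewrite in_supp => + fe; apply: contra => fB; rewrite Y0.
have KD : K \subset ~: D.
  by apply/subsetP => z /setD1P[ze zB]; rewrite in_setC in_supp negbK Y0.
have mK : maxindep F (~: D) K.
  apply: maxindepP => // [|x]; first exact: indepS (subsetDl _ _) iB.
  rewrite in_setC in_supp negbK => /eqP Yx xK.
  have xe : x != e by apply: contraPneq Yx => ->; rewrite Ye.
  have xB : x \notin B by move: xK; rewrite in_setD1 xe.
  (* As Y_x = 0, the fundamental circuit X of x has X_e = 0, so it lies in [x |: K]. *)
  have [X cX sX] := maxindep_hcirc mB (in_setT x) xB.
  apply/negP => ix; apply: (indep_circF ix (supp_circ cX)).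
  rewrite -(setU1K (a := e) (B := x |: K)) ?in_setU1 ?in_setD1 ?eqxx ?orbF 1?eq_sym //.
  rewrite setUCA BK subsetD1 sX in_supp -(YX X x) // Yx gmulr0 eqxx //.
have hK : hyperplane_basis D K.
  split=> // f fD; have [->|fe] := eqVneq f e; first by rewrite BK.
  have fB := DB f fD fe.
  have [X cX sX] := maxindep_hcirc mB (in_setT f) fB.
  have -> : f |: K = (f |: B) :\ e.
    by apply/setP => z; rewrite !inE; case: eqVneq => // ->; rewrite fe.
  apply: (maxindep_exchange elimF mB (in_setT f) (supp_circ cX) sX).
  by rewrite in_supp -(YX X f) // gmul_neq0 (circ_add_neq0 iB) // -in_supp.
have aK : adapted Y K.
  split=> // X f g cX fD gD fg sX.
  have base h : h \in D -> h != e -> supp X \subset h |: (e |: K) -> X h * Y h = X e * Y e.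
    by rewrite BK Ye mulg1 => hD he sXh; apply: YX; rewrite ?DB.
  have [fe|fe] := eqVneq f e.
    by rewrite fe; apply/esym/base; rewrite // -?fe 1?eq_sym // setUCA.
  have [ge|ge] := eqVneq g e; first by rewrite ge; apply: base; rewrite // -ge.
  have [P cP sP] := maxindep_hcirc mB (in_setT f) (DB f fD fe).
  have [Q cQ sQ] := maxindep_hcirc mB (in_setT g) (DB g gD ge).
  have He h R : h \in D -> h != e -> circ R -> supp R \subset h |: B -> R e != hzero.
    move=> hD he cR sR; rewrite -(YX R h) ?DB // gmul_neq0 (circ_add_neq0 iB) //.
    by rewrite -in_supp.
  have Qf : Q f = hzero.
    by apply: supp_subF sQ _; rewrite in_setU1 (negPf fg) /= DB.
  have Pg : P g = hzero.
    by apply: supp_subF sP _; rewrite in_setU1 eq_sym (negPf fg) /= DB.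
  have PQ : supp P != supp Q.
    apply: contraTneq (circ_add_neq0 iB cP sP) => ePQ.
    by rewrite -in_supp ePQ in_supp Qf eqxx.
  have sP' : supp P \subset f |: (g |: B).
    by apply: subset_trans sP _; rewrite setUS // subsetUr.
  have sQ' : supp Q \subset f |: (g |: B) by apply: subset_trans sQ (subsetUr _ _).
  (* Eliminating e gives Z with Z_f = P_f and Z_g = a Q_g, so Z_f Y_f = P_e and Z_g Y_g = a Q_e =
     P_e. *)
  have [a [Z [aQ cZ sZ hZ]]] := hyper_elim iB cP cQ PQ sP' sQ'
    (He f P fD fe cP sP) (He g Q gD ge cQ sQ).
  have sZ' : supp Z \subset f |: (g |: K).
    apply: subset_trans sZ _; apply/subsetP => z /setD1P[ze].
    have : supp P :|: supp Q \subset f |: (g |: B) by rewrite subUset sP'.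
    by move/subsetP => h /h; rewrite !inE ze.
  have [l lX] := circ_proportional (maxindep_indep (hK.2 g gD)) cX cZ sX sZ'.
  have Zf : Z f = P f by have := hZ f; rewrite Qf gmulr0 => /haddx0.
  have Zg : Z g = a * Q g by have := hZ g; rewrite Pg => /hadd0x.
  by rewrite !lX Zf Zg -!mulgA (YX P f) ?DB // (YX Q g) ?DB // aQ.
split=> [|X cX]; last exact: adapted_orthogonal aK cX.
(* No basis avoids D, since the complement of D has rank #|K| < #|B|. A subset of D missing f avoids
   the basis [f |: K]. *)
apply/minsetP; split=> [|D' nD' sD'].
  apply/negP => /existsP[B2 /andP[]]; rewrite basisE => mB2.
  rewrite subsetC => sB2.
  have := card_maxindep elimF mK (maxindep_indep mB2) sB2.
  by rewrite (eq_card_maxindep elimF mB2 mB) -BK cardsU1 !inE eqxx add1n ltnn.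
apply/eqP; rewrite eqEsubset sD'; apply: contraT => /subsetPn[f fD fD'].
case/negP: nD'; apply/existsP; exists (f |: K); rewrite basisE hK.2 //=.
apply/subsetP => z zD'; rewrite in_setC in_setU1 negb_or; apply/andP; split.
  by apply: contraNneq fD' => <-.
by apply/negP => /(subsetP KD); rewrite in_setC (subsetP sD').
Qed.

Lemma vector_dominates_circuit V e : vectors M V -> V e != hzero ->
  exists X, [/\ circ X, X e = V e & forall f, gle (X f) (V f)].
Proof.
move=> vV Ve; pose W f := ginv (V f).
have [J [mJ oJ]] := optimal_basis_exists W (supp V).
suff [X [cX sX Xe mX]] : exists X, [/\ circ X, supp X \subset supp V, X e != hzero
    & forall f, gle (X f * W f) (X e * W e)].
  (* After this scaling the maximal value at e is 1, so multiplying on the right by V_f gives a X_f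
     <= V_f. *)
  have [a aX caX] := scale_to cX Xe Ve.
  exists [ffun f => a * X f]; split=> // [|f]; rewrite ffunE //.
  have [Vf|Vf] := eqVneq (V f) hzero.
    by rewrite (@supp_subF X (supp V)) ?in_supp ?Vf ?eqxx // gmulr0 gle0.
  have := gle_mul2r (V f) (gle_mul2l a (mX f)).
  by rewrite /W !(mulgA a) aX gmulV // mul1g -(mulgA (a * X f)) gmulVx // mulg1.
have iJ := maxindep_indep mJ.
have eV : e \in supp V by rewrite in_supp.
have sub f : f \in supp V -> f |: J \subset supp V.
  by move=> fV; rewrite subUset sub1set fV (maxindep_sub mJ).
have [eJ|eJ] := boolP (e \in J); last first.
  have [X cX sX] := maxindep_hcirc mJ eV eJ.
  exists X; split=> //; [exact: subset_trans sX (sub e eV) | exact: circ_add_neq0 sX |].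
  exact: oJ.
have [B mB JB] := maxindep_exists (subsetT J) iJ.
have [Y [cY Ye Y0 YX]] := fundamental_cocircuit mB (subsetP JB _ eJ).
have /orthogonalP/(_ e) := vV Y cY; rewrite Ye mulg1 => /(_ Ve)[f fe VY].
have := gle_neq0 VY Ve; rewrite gmul_neq0 => /andP[Vf Yf].
have fV : f \in supp V by rewrite in_supp.
have fB : f \notin B by apply: contra Yf => fB; rewrite Y0.
have fJ : f \notin J by apply: contra fB; apply: (subsetP JB).
have [X cX sX] := maxindep_hcirc mJ fV fJ.
have Xf := circ_add_neq0 iJ cX sX.
have XY := YX X f cX fB (subset_trans sX (setUS _ JB)).
exists X; split=> // [||g]; first exact: subset_trans sX (sub f fV).
  by rewrite -XY gmul_neq0 Xf.
(* The maximum at f is also attained at e: inserting V_e <= V_f Y_f between W_f and W_e bounds X_f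
   W_f by X_f Y_f W_e = X_e W_e. *)
apply: gle_trans (oJ X f cX fV fJ sX g) _.
have := gle_mul2r (W e) (gle_mul2l (X f * W f) VY).
by rewrite /W -(mulgA (X f * _) (V e)) gmulV // mulg1 -(mulgA (X f)) (mulgA (W f)) gmulVx // mul1g XY.
Qed.

Lemma gamma_max_matroid_perfect : perfect_matroid M.
Proof.
move=> V U vV cU; apply/orthogonalP => e VUe.
have /andP[Ve _] : (V e != hzero) && (U e != hzero) by rewrite -gmul_neq0.
have [X [cX Xe XV]] := vector_dominates_circuit vV Ve.
have /orthogonalP/(_ e) := cU X cX; rewrite Xe => /(_ VUe)[f fe XU].
by exists f => //; apply: gle_trans XU _; apply: gle_mul2r.
Qed.

End GammaMaxMatroid.

Theorem theorem20 (d : Order.disp_t) (G : orderedGroupType d) :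
  perfect_hyperfield (Gamma_max G).
Proof. by move=> E M; apply: gamma_max_matroid_perfect. Qed.
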